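(* Let $\varphi$ be a measure function such that $$\lim_{t\to0^+}\frac{\varphi(t)}{t^s}=0$$ for any $0<s<1$. Then there exist a finite Blaschke product $f$ with $f(0)=0$ which is not a rotation and a sequence $\{a_n\}_{n\ge1}=\{a_n\}(\varphi,f)$ of complex numbers tending to zero with $\sum_n|a_n|=\infty$ such that for any $w\in\mathbb{C}$, the set $$A(w)=\left\{\xi\in\partial\mathbb{D}\colon\sum_{n=1}^\infty a_nf^n(\xi)\text{ converges and }\sum_{n=1}^\infty a_nf^n(\xi)=w\right\}$$ has Hausdorff measure $\mathcal{H}^\varphi(A(w))=0$.
   Context: $\mathbb{D}$ is the open unit disk and $\partial\mathbb{D}$ the unit circle. A finite Blaschke product with $f(0)=0$ is $f(z)=\alpha z^m\prod_{n=1}^N\frac{z-z_n}{1-\overline{z_n}z}$ with $|\alpha|=1$, $m\ge1$, and $\{z_n\}_{n=1}^N\subset\mathbb{D}$ finite and possibly empty. A rotation is $z\mapsto\alpha z$, $|\alpha|=1$. $f^n$ denotes the $n$-th iterate of $f$. A measure function is a function $\varphi\colon[0,\infty)\to[0,\infty)$ with $\varphi(0)=0$ which is strictly increasing and right-continuous. For an arc $I$, $\mathrm{m}(I)$ is its normalised length ($\mathrm{m}(\partial\mathbb{D})=1$). For $E\subseteq\partial\mathbb{D}$, $$\mathcal{H}^\varphi(E)=\lim_{\delta\to0^+}\inf\left\{\sum_{n=1}^\infty\varphi(\mathrm{m}(I_n))\colon E\subseteq\bigcup_{n=1}^\infty I_n,\ \mathrm{m}(I_n)<\delta\text{ for }n\ge1\right\},$$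 the infimum being over countable covers of $E$ by arcs. *)

(* Defs.v *)
From HB Require Import structures.
From mathcomp Require Import all_boot all_order all_algebra.
From mathcomp Require Import all_classical all_reals all_analysis.
From mathcomp Require Import complex.
Set Implicit Arguments.
Unset Strict Implicit.
Unset Printing Implicit Defensive.
Import Order.TTheory GRing.Theory Num.Theory numFieldNormedType.Exports.
Local Open Scope classical_set_scope.
Local Open Scope ring_scope.

(** The complex plane is [R[i]] for [R : realType]; its topology is the one
    [R[i]^o] carries as a normed space over itself.  [`|z|] lives in [R[i]]
    (with zero imaginary part), [Normc.normc z] is the same modulus seen
    in [R]. *)

Definition unit_circle (R : realType) : set R[i] := [set z | `|z| = 1].

Definition blaschke (R : realType) (alpha : R[i]) (m : nat) (zs : seq R[i])
    (z : R[i]) : R[i] :=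
  alpha * z ^+ m * \prod_(b <- zs) ((z - b) / (1 - b^* * z)).

(** Blaschke products are regarded as functions on the closed unit disk: the
    values of [f] elsewhere, in particular at the poles, are irrelevant.  The
    condition [0 < m] says that [f 0 = 0]. *)
Definition finite_blaschke0 (R : realType) (f : R[i] -> R[i]) : Prop :=
  exists (alpha : R[i]) (m : nat) (zs : seq R[i]),
    [/\ `|alpha| = 1, (0 < m)%N, (forall b, b \in zs -> `|b| < 1) &
        forall z, `|z| <= 1 -> f z = blaschke alpha m zs z].

Definition rotation (R : realType) (f : R[i] -> R[i]) : Prop :=
  exists2 alpha : R[i], `|alpha| = 1 & forall z, `|z| < 1 -> f z = alpha * z.

(** Only the values of [phi] on [[0, +oo[] matter. *)
Definition measure_function (R : realType) (phi : R -> R) : Prop :=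
  [/\ phi 0 = 0,
      (forall t, 0 <= t -> 0 <= phi t),
      (forall s t, 0 <= s -> s < t -> phi s < phi t) &
      (forall t, 0 <= t -> phi x @[x --> t^'+] --> phi t)].

(** An arc is the image under [t |-> exp(2 pi i t)] of an interval with
    endpoints [arc_l <= arc_r <= arc_l + 1], each of which may or may not belong
    to it; its normalised length is [arc_r - arc_l].  Degenerate arcs are
    allowed: since [phi 0 = 0] and [phi] is right-continuous they do not change
    Hausdorff measures, and they let a finite cover be written as a sequence. *)
Record arc (R : realType) := Arc {
  arc_l : R;
  arc_r : R;
  arc_lclosed : bool;
  arc_rclosed : bool;
  arc_le : arc_l <= arc_r;
  arc_turn : arc_r <= arc_l + 1 }.

Definition circle_point (R : realType) (t : R) : R[i] :=
  (cos (2 * pi * t) +i* sin (2 * pi * t))%C.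

(** [BSide b x] includes the point [x] as a left endpoint when [b = true] and as
    a right endpoint when [b = false]. *)
Definition arc_set (R : realType) (I : arc R) : set R[i] :=
  @circle_point R @`
    [set` Interval (BSide (arc_lclosed I) (arc_l I))
                   (BSide (~~ arc_rclosed I) (arc_r I))].

Definition arc_length (R : realType) (I : arc R) : R := arc_r I - arc_l I.

Definition hausdorff_content (R : realType) (phi : R -> R) (delta : R)
    (E : set R[i]) : \bar R :=
  ereal_inf [set (\sum_(0 <= n <oo) (phi (arc_length (I n)))%:E)%E | I in
    [set I : nat -> arc R | E `<=` \bigcup_n arc_set (I n) /\
                            forall n, arc_length (I n) < delta]].

Definition hausdorff_measure (R : realType) (phi : R -> R) (E : set R[i])
    : \bar R :=
  lim (hausdorff_content phi delta E @[delta --> 0^'+]).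

(** The limit above always exists, so [lim] never takes its default value. *)
Lemma hausdorff_measure_cvg (R : realType) (phi : R -> R) (E : set R[i]) :
  hausdorff_content phi delta E @[delta --> 0^'+] --> hausdorff_measure phi E.
Proof.
have h : {in `]0, +oo[ &,
    nonincreasing_fun (fun d => hausdorff_content phi d E)}.
  move=> x y _ _ xy; apply: ereal_inf_le_tmp => _ [I [EI Id] <-].
  by exists I => //; split=> // n; exact: lt_le_trans (Id n) xy.
by apply: cvgP; apply: nonincreasing_at_right_cvge h.
Qed.

(** [iter n f xi] is the [n]-th iterate; the series starts at [n = 1]. *)
Definition iterate_series (R : realType) (a : nat -> R[i]) (f : R[i] -> R[i])
    (xi : R[i]) (N : nat) : R[i]^o :=
  \sum_(1 <= n < N.+1) a n * iter n f xi.

Definition sum_level_set (R : realType) (a : nat -> R[i]) (f : R[i] -> R[i])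
    (w : R[i]) : set R[i] :=
  [set xi | unit_circle xi /\
            iterate_series a f xi N @[N --> \oo] --> (w : R[i]^o)].

(* Main.v *)
(** Take [f z = z ^+ 8] and let the coefficients be constant, equal to
    [1 / (k + 1)], on the [k]-th of consecutive blocks of indices.  Cut that
    block into runs of [q = 2 k + 4] indices.  If the base-8 digits of [t] along
    a run all vanish, then every [cos (2 pi 8^l t)] in the run is at least [1 / 2] and
    the run contributes more than [1] to the real part of the series at
    [exp (2 pi i t)].  Convergence therefore forbids this for all runs of all
    late blocks: in base [B = 8^q] the corresponding digits are nonzero.  After
    [r] runs only a proportion [((B - 1) / B)^r] of the cells of size
    [8^-S B^-r] survives, and their total [phi]-size tends to [0] as [r] grows,
    by the hypothesis on [phi] with [s = ln (B - 1) / ln B].  So the lengths of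
    the blocks can be chosen one after the other to make these totals summable;
    the covers given by all blocks after a late one then cover the level set. *)
Require Import Defs.
From HB Require Import structures.
From mathcomp Require Import all_boot all_order all_algebra.
From mathcomp Require Import all_classical all_reals all_analysis.
From mathcomp Require Import complex.
From mathcomp Require Import ring lra zify.
Import Order.TTheory GRing.Theory Num.Theory numFieldNormedType.Exports.
Local Open Scope classical_set_scope.
Local Open Scope ring_scope.

(** * Angles on the circle, powers and cosines *)

Lemma unit_circleP (R : realType) (xi : R[i]) :
  unit_circle xi -> exists2 t : R, 0 <= t < 1 & xi = circle_point t.
Proof.
case: xi => a b; rewrite /unit_circle /= normc_def => -[] /= h.
have ab : a ^+ 2 + b ^+ 2 = 1.
  by rewrite -[LHS]sqr_sqrtr ?h ?expr1n// addr_ge0// sqr_ge0.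
have a1 : -1 <= a <= 1 by apply/andP; split; nra.
have pi0 := pi_gt0 R; have pi2 : 2 * pi != 0 :> R by rewrite gt_eqF ?mulr_gt0.
have sa : sin (acos a) = `|b|.
  by rewrite sin_acos// -sqrtr_sqr -ab; congr Num.sqrt; ring.
have ca : cos (acos a) = a by rewrite acosK.
have sc t x : x = 2 * pi * t -> cos x = a -> sin x = b ->
    (a +i* b)%C = circle_point t.
  by move=> xt cx sx; rewrite /circle_point -xt cx sx.
have ac0 := acos_ge0 a1; have acpi := acos_lepi a1.
have [b0|b0] := lerP 0 b.
  exists (acos a / (2 * pi)).
    by rewrite divr_ge0 ?mulr_ge0 ?pi_ge0//= ltr_pdivrMr ?mulr_gt0// mul1r; lra.
  apply: sc ca _; first by rewrite mulrC divfK.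
  by rewrite sa ger0_norm.
(* Strictness keeps the parameter [1 - acos a / (2 * pi)] of the lower half circle below 1; it holds
   because [a = 1] would force [b = 0]. *)
have ac : 0 < acos a.
  by apply: acos_gt0; case/andP: a1 => -> a1 /=; rewrite lt_neqAle a1 andbT;
  apply/eqP => a1'; move: ab; rewrite a1'; nra.
exists (1 - acos a / (2 * pi)).
  rewrite subr_ge0 ltrBlDr ltrDl divr_gt0 ?mulr_gt0// andbT.
  by rewrite ler_pdivrMr ?mulr_gt0// mul1r; lra.
apply: (sc _ (- acos a + pi *+ 2)).
- by rewrite mulrBr [X in _ - X]mulrC divfK// mulr2n; ring.
- by rewrite cosD2pi cosN.
- by rewrite sinD2pi sinN sa ltr0_norm// opprK.
Qed.

Lemma circle_pointX (R : realType) (t : R) n :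
  circle_point t ^+ n = circle_point (n%:R * t).
Proof.
elim: n => [|n IH]; first by rewrite expr0 /circle_point mul0r mulr0 cos0 sin0.
have e : 2 * pi * (n.+1%:R * t) = 2 * pi * t + 2 * pi * (n%:R * t).
  by rewrite -[n.+1%:R]natr1; ring.
rewrite exprS IH /circle_point e cosD sinD.
by apply/eqP; rewrite eq_complex /=; apply/andP; split; apply/eqP; ring.
Qed.

Lemma iter_expr (T : pzRingType) (x : T) m n :
  iter n (fun z => z ^+ m) x = x ^+ (m ^ n).
Proof. by elim: n => [|n IH] //=; rewrite IH -exprM expnSr. Qed.

(** Modulo full turns the angle [z] lies in [0, pi/4], so [cos (2 z) >= 0]. The double-angle formula
    then gives [cos z ^ 2 >= 1/2], which is more than enough. *)
Lemma cos_ge_half (R : realType) (x : R) (m : nat) :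
  m%:R <= x -> x <= m%:R + 8^-1 -> 1 / 2 <= cos (2 * pi * x).
Proof.
move=> mx xm; have pi0 := pi_gt0 R.
have -> : 2 * pi * x = 2 * pi * (x - m%:R) + (pi *+ 2) *+ m.
  by rewrite -mulr_natr -[pi *+ 2]mulr_natr; ring.
have {mx xm} [y0 y8] : 0 <= x - m%:R /\ x - m%:R <= 8^-1 by lra.
move: (x - _) y0 y8 => y y0 y8.
have -> : cos (2 * pi * y + pi *+ 2 *+ m) = cos (2 * pi * y).
  elim: m => [|m IH]; first by rewrite mulr0n addr0.
  by rewrite [_ *+ m.+1]mulrSr addrA cosD2pi.
set z := 2 * pi * y; have z0 : 0 <= z by rewrite !mulr_ge0// ltW.
have z4 : z <= pi / 4.
  by rewrite /z -mulrA mulrCA ler_wpM2l ?pi_ge0//; lra.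
move: z z0 z4 => z z0 z4.
have [zl zu zzl zzu] : [/\ - (pi / 2) <= z, z <= pi / 2, - (pi / 2) <= z + z
    & z + z <= pi / 2].
  by move: (pi : R) pi0 z4 => p p0 z4; split; lra.
have c0 : 0 <= cos z by rewrite cos_ge0_pihalf// zl.
have : 0 <= cos (z *+ 2) by rewrite cos_ge0_pihalf// mulr2n zzl.
rewrite cos_mulr2n mulr2n; nra.
Qed.

(** * Null sets from finite batches of arcs *)

Definition point_arc (R : realType) : Defs.arc R :=
  @Arc R 0 0 true true (lexx 0) (ler_wpDl (lexx 0) ler01).

(** The batches cost at most [eps] in total, since the bounds [eps / 2 ^ k.+1] sum to [eps]. A
    bijection between [nat] and [nat * nat] lists all of them as one sequence of arcs. *)
Lemma hausdorff_measure_eq0 (R : realType) (phi : R -> R) (E : set R[i]) :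
  measure_function phi ->
  (forall delta eps : R, 0 < delta -> 0 < eps ->
    exists (n : nat -> nat) (J : nat -> nat -> Defs.arc R),
    [/\ forall x, E x -> exists k i, (i < n k)%N /\ arc_set (J k i) x,
        forall k i, arc_length (J k i) < delta &
        forall k, \sum_(0 <= i < n k) phi (arc_length (J k i))
                    <= eps / (2 ^ k.+1)%:R]) ->
  hausdorff_measure phi E = 0%E.
Proof.
move=> [phi0 phi_ge0 _ _] cov.
have len0 I : 0 <= arc_length I by rewrite subr_ge0 arc_le.
apply/cvg_lim; first exact: ereal_hausdorff.
apply: cvg_near_cst; near=> delta; apply/eqP; rewrite eq_le.
apply/andP; split; last first.
  apply: le_ereal_inf_tmp => _ [I _ <-].
  by apply: nneseries_ge0 => n _ _; rewrite lee_fin phi_ge0.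
apply/lee_addgt0Pr => eps eps0; rewrite add0e.
have delta0 : 0 < delta by near: delta; exact: nbhs_right_gt.
have [n [J [Jcov Jlen Jsum]]] := cov _ _ delta0 eps0.
(* Slots beyond the end of a batch hold an arc of length zero, which costs [phi 0 = 0]. *)
pose J' (p : nat * nat) := if (p.2 < n p.1)%N then J p.1 p.2 else point_arc R.
have /ppcard_eqP[e] : ([set: nat] #= [set: nat * nat])%card.
  by apply/card_esym/card_nat2.
apply: (@le_trans _ _ (\sum_(0 <= m <oo) (phi (arc_length (J' (e m))))%:E)%E).
  apply: ereal_inf_lbound; exists (J' \o e) => //; split.
    move=> x /Jcov[k [i [ik xki]]].
    exists ((e^-1)%FUN (k, i)) => //=.
    by rewrite invK ?inE// /J' ik.
  move=> m; rewrite /= /J'; case: ifP => _ //.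
  by rewrite /arc_length /= subrr.
rewrite nneseries_esumT; last by move=> m; rewrite lee_fin phi_ge0.
rewrite -(reindex_esum [set: nat] [set: nat * nat] e
  (fun p => (phi (arc_length (J' p)))%:E)); last exact: bij.
have -> : [set: nat * nat] = [set: nat] `*`` (fun=> [set: nat]).
  by apply/seteqP; split.
rewrite -(@esum_esum _ _ _ _ _
  (fun k i => (phi (arc_length (J' (k, i))))%:E)); last first.
  by move=> *; rewrite lee_fin phi_ge0.
rewrite -nneseries_esumT; last first.
  by move=> k; apply: esum_ge0 => i _; rewrite lee_fin phi_ge0.
apply: (@le_trans _ _ (\sum_(0 <= k <oo) (0 + (eps / (2 ^ k.+1)%:R)%:E))%E).
  apply: lee_nneseries.
    by move=> k _ _; apply: esum_ge0 => i _; rewrite lee_fin phi_ge0.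
  move=> k _; rewrite -nneseries_esumT; last first.
    by move=> i; rewrite lee_fin phi_ge0.
  rewrite add0e (@nneseries_split _ _ 0 (n k)); last first.
    by move=> i _; rewrite lee_fin phi_ge0.
  rewrite add0n eseries0 ?adde0; last first.
    by move=> i /= ik _; rewrite /J' /= ltnNge ik /= /arc_length /= subrr phi0.
  rewrite sumEFin lee_fin; apply: le_trans (Jsum k).
  rewrite big_nat [leRHS]big_nat; apply: ler_sum => i /= ik.
  by rewrite /J' /= ik.
apply: le_trans (epsilon_trick _ _ _) _ => //; first exact: ltW.
by rewrite eseries0// add0e.
Unshelve. all: by end_near.
Qed.

(** * Counting cells with nonzero digits *)

(** Only the last [r] base-[B] digits are constrained; what precedes them ranges
    over [[0, T)]. *)
Definition nonzero_digits (T B r : nat) : seq nat :=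
  iter r (fun s => [seq (B * j + d)%N | j <- s, d <- iota 1 B.-1]) (iota 0 T).

Lemma size_nonzero_digits T B r :
  size (nonzero_digits T B r) = (T * B.-1 ^ r)%N.
Proof.
elim: r => [|r IH]; first by rewrite size_iota muln1.
by rewrite /= size_allpairs size_iota -/(nonzero_digits T B r) IH expnSr mulnA.
Qed.

(** If [j] is the integer part of [x = T * B ^ r * t], the next base-[B] digit is the integer part
    of [B * (x - j)]. Were it zero, [x] would lie within [1 / B] above [j], which the hypothesis
    excludes. *)
Lemma nonzero_digitsP (R : realType) (T B r : nat) (t : R) :
  (0 < T)%N -> (1 < B)%N -> 0 <= t < 1 ->
  (forall i, (i < r)%N -> ~ exists j : nat,
     j%:R <= (T * B ^ i)%:R * t <= j%:R + B%:R^-1) ->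
  exists2 j, j \in nonzero_digits T B r & j%:R <= (T * B ^ r)%:R * t < j.+1%:R.
Proof.
move=> T0 B1 /andP[t0 t1]; have B0 : 0 < B%:R :> R by rewrite ltr0n; lia.
elim: r => [|r IH] h.
  rewrite expn0 muln1; have Tt0 : 0 <= T%:R * t by rewrite mulr_ge0.
  exists (Num.truncn (T%:R * t)); last exact: truncn_itv.
  rewrite mem_iota /= add0n truncn_lt_nat// -[ltRHS]mulr1 ltr_pM2l// ltr0n//.
have [|j jr /andP[j1 j2]] := IH; first by move=> i ir; apply: h; exact: ltnW.
pose x : R := (T * B ^ r)%:R * t.
have xB : (T * B ^ r.+1)%:R * t = B%:R * x.
  by rewrite /x expnSr mulnA natrM; ring.
have y0 : 0 <= B%:R * (x - j%:R) by rewrite mulr_ge0 ?subr_ge0// ltW.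
have /andP[d1 d2] := truncn_itv y0.
set d := Num.truncn _ in d1 d2.
exists (B * j + d)%N; last first.
  rewrite xB -addnS !natrD natrM; move: d1 d2; rewrite mulrBr => d1 d2.
  by apply/andP; split; lra.
apply: allpairs_f => //; rewrite mem_iota; apply/andP; split.
  rewrite lt0n; apply/eqP => d0; apply: (h r (ltnSn r)); exists j.
  rewrite j1 /= -lerBlDl -[leRHS]mul1r ler_pdivlMr// mulrC ltW//.
  by move: d2; rewrite d0.
suff : (d < B)%N by lia.
rewrite truncn_lt_nat// -[ltRHS]mulr1 ltr_pM2l// ltrBlDr.
by move: j2; rewrite -natr1 addrC.
Qed.

(* [s] is chosen so that [B `^ s = B - 1]. *)
Lemma measure_function_digits (R : realType) (phi : R -> R) (T B : nat)
    (eps : R) :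
  (forall s : R, 0 < s -> s < 1 ->
    phi t / (t `^ s) @[t --> 0^'+] --> (0 : R)) ->
  (0 < T)%N -> (2 < B)%N -> 0 < eps ->
  exists r, (0 < r)%N /\
    (T * B.-1 ^ r)%:R * phi ((T * B ^ r)%:R^-1) <= eps.
Proof.
move=> hlim T0 B2 eps0.
have B1 : 1 < B%:R :> R by rewrite ltr1n; lia.
(* This uses [2 < B] and is what makes the exponent [s] positive. *)
have B11 : 1 < B.-1%:R :> R by rewrite ltr1n; lia.
have lnB : 0 < ln (B%:R : R) by rewrite ln_gt0.
pose s : R := ln B.-1%:R / ln B%:R.
have s0 : 0 < s by rewrite divr_gt0// ln_gt0.
have s1 : s < 1.
  by rewrite ltr_pdivrMr// mul1r ltr_ln ?posrE ?ltr_nat; [lia|lra|lra].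
have Bs : B%:R `^ s = B.-1%:R.
  rewrite /powR gt_eqF; last lra.
  by rewrite divfK ?gt_eqF// lnK// posrE; lra.
have T0' : 0 < T%:R :> R by rewrite ltr0n.
(* The tolerance is divided by [T] to absorb the factor [T] in the number of cells. *)
have e0 : 0 < eps / T%:R by rewrite divr_gt0.
have := hlim s s0 s1; move/cvgrPdist_le => /(_ _ e0) [d /= d0 hd].
have [r [r0 rd]] : exists r, (0 < r)%N /\ ((T * B ^ r)%:R^-1 : R) < d.
  have [n nd] : exists n, d^-1 < n%:R.
    by exists (Num.truncn d^-1).+1; exact: truncnS_gt.
  exists n.+1; split=> //; rewrite invf_plt ?posrE//; last first.
    by rewrite ltr0n muln_gt0 T0 expn_gt0; lia.
  apply: lt_le_trans nd _; rewrite ler_nat.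
  have : (n.+1 < B ^ n.+1)%N by apply: ltn_expl; lia.
  nia.
exists r; split=> //.
set t := (T * B ^ r)%:R^-1 in rd *.
have t0 : 0 < t by rewrite invr_gt0 ltr0n muln_gt0 T0 expn_gt0; lia.
have := hd t; rewrite /= sub0r normrN gtr0_norm// => /(_ rd t0).
rewrite sub0r normrN => /(le_trans (ler_norm _)).
rewrite ler_pdivrMr ?powR_gt0// => ht.
(* As [B]^ s = B - 1[, the left side equals]T [^ (- s)], and [T >= 1]. *)
have ts : B.-1%:R ^+ r * t `^ s <= 1.
  rewrite /t -powR_inv1 ?ler0n// -powRrM mulN1r powRN natrM natrX.
  rewrite powRM ?ler0n// ?exprn_ge0 ?ler0n//.
  have -> : (B%:R ^+ r) `^ s = B.-1%:R ^+ r :> R.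
    by rewrite -powR_mulrn ?ler0n// -powRrM mulrC powRrM Bs powR_mulrn ?ler0n.
  have Br : 0 < B.-1%:R ^+ r :> R by rewrite exprn_gt0//; lra.
  have Ts : 1 <= T%:R `^ s :> R.
    by rewrite -[leLHS](powRr0 T%:R); apply: ler_powR; rewrite ?ler1n// ltW.
  rewrite invfM mulrCA divff ?gt_eqF// mulr1 invf_le1//; lra.
rewrite natrM natrX.
apply: le_trans (_ : T%:R * B.-1%:R ^+ r * (eps / T%:R * t `^ s) <= _).
  by rewrite ler_pM2l// mulr_gt0 ?exprn_gt0//; lra.
rewrite (_ : _ * _ = eps * (B.-1%:R ^+ r * t `^ s)); last first.
  by field; rewrite gt_eqF.
by rewrite -[leRHS]mulr1 ler_pM2l.
Qed.

(** * Real parts of the partial sums *)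

Lemma Re_sum (R : rcfType) (I : Type) (r : seq I) (F : I -> R[i]) :
  complex.Re (\sum_(i <- r) F i) = \sum_(i <- r) complex.Re (F i).
Proof. by apply: (big_morph (@complex.Re R)) => // -[a b] [c d]. Qed.

(** Partial sums within 1/2 of [w] differ by at most 1 in modulus, hence in real part. The cosines
    are the real parts of the iterates of [z ^+ 8]. *)
Lemma iterate_series_Cauchy (R : realType) (c : nat -> R) (t : R) (w : R[i]) :
  iterate_series (fun n => (c n)%:C%C) (fun z => z ^+ 8) (circle_point t) N
    @[N --> \oo] --> (w : R[i]^o) ->
  exists N0, forall m n, (N0 <= m)%N -> (m <= n)%N ->
    \sum_(m <= i < n) c i * cos (2 * pi * ((8 ^ i)%:R * t)) <= 1.
Proof.
move=> /cvgrPdist_lt /(_ (2^-1)); rewrite invr_gt0 ltr0n => /(_ isT) [N0 _ hN].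
(* The sum over [m <= i < n] is the difference of the partial sums of index [n - 1] and [m - 1],
   hence the shift by one. *)
exists N0.+1 => m n mN mn.
case: m mN mn => // m mN mn; case: n mn => // n mn.
have hm := hN m mN; have hn := hN n (leq_trans mN mn).
rewrite /= in hm hn.
set P := iterate_series _ _ _ in hm hn.
have hP : `|P n - P m| <= 1 :> R[i].
  have -> : P n - P m = (w - P m) - (w - P n).
    by rewrite opprB [RHS]addrC addrA subrK.
  apply: le_trans (ler_normB _ _) _.
  apply: ltW; apply: lt_le_trans (ltrD hm hn) _.
  by rewrite -[2^-1]mul1r -splitr.
apply: le_trans (ler_norm _) _.
rewrite -lecR; apply: le_trans hP.
apply: le_trans (normc_ge_Re _).
rewrite lecR le_eqVlt; apply/orP; left; apply/eqP; congr `|_|.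
have -> : P n - P m = \sum_(m.+1 <= i < n.+1)
    (c i)%:C%C * iter i (fun z => z ^+ 8) (circle_point t) :> R[i].
  rewrite /P /iterate_series (@big_cat_nat _ _ _ m.+1 1 n.+1) //=.
  by rewrite addrC addrK.
rewrite (Re_sum _ _ (index_iota _ _)); apply: eq_bigr => i _.
by rewrite iter_expr circle_pointX /circle_point /= mul0r subr0.
Qed.

(** * Blocks of indices and their coefficients *)

Section lacunary_blocks.
Variables (R : realType) (r : nat -> nat -> nat).
Hypothesis r_gt0 : forall k s, (0 < r k s)%N.

(** [r k s] is the number of runs in block [k] if that block starts at index [s]; thus it may depend
    on all earlier blocks. The first block starts at 1, like the series. *)
Fixpoint block_start k :=
  if k is k'.+1 then (block_start k' + (2 * k').+4 * r k' (block_start k'))%N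
  else 1%N.

Lemma block_start_ltn k : (block_start k < block_start k.+1)%N.
Proof. by rewrite /= -[ltnLHS]addn0 ltn_add2l muln_gt0 r_gt0. Qed.

Lemma block_start_homo : {homo block_start : j k / (j <= k)%N}.
Proof.
apply: homo_leq => //; first exact: leq_trans.
by move=> k; exact: ltnW (block_start_ltn k).
Qed.

Lemma ltn_block_start k : (k < block_start k)%N.
Proof. by elim: k => // k /leq_ltn_trans; apply; exact: block_start_ltn. Qed.

Lemma block_exists n : exists k, (n < block_start k.+1)%N.
Proof. by exists n; exact: ltn_trans (ltn_block_start n.+1). Qed.

Definition block_index n := ex_minn (block_exists n).

Lemma block_indexE k n : (block_start k <= n < block_start k.+1)%N ->
  block_index n = k.
Proof.
move=> /andP[kn nk]; rewrite /block_index; case: ex_minnP => j nj jmin.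
apply/eqP; rewrite eqn_leq jmin//= leqNgt; apply/negP => jk.
by move: (leq_trans (block_start_homo _ _ jk) kn); rewrite leqNgt nj.
Qed.

Lemma leq_block_index k n : (block_start k <= n)%N -> (k <= block_index n)%N.
Proof.
move=> kn; rewrite /block_index; case: ex_minnP => j nj _.
rewrite leqNgt; apply/negP => jk.
by move: (leq_trans (block_start_homo _ _ jk) kn); rewrite leqNgt nj.
Qed.

Definition block_coef n : R := (block_index n).+1%:R^-1.

Lemma block_coef_le k n : (block_start k <= n)%N -> block_coef n <= k.+1%:R^-1.
Proof.
move=> /leq_block_index kn.
by rewrite /block_coef lef_pV2 ?posrE ?ltr0n// ler_nat.
Qed.

(** Each block contributes at least 1: block [k] has at least [2 k + 4] indices, with coefficient
    [1 / (k + 1)]. *)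
Lemma block_coef_sum K : K%:R <= \sum_(1 <= n < block_start K) block_coef n.
Proof.
elim: K => [|K IH]; first by rewrite /= big_geq.
rewrite (@big_cat_nat _ _ _ (block_start K)) /=; last first.
- exact: ltnW (block_start_ltn K).
- exact: leq_ltn_trans (ltn_block_start K).
rewrite -natr1 lerD//.
have -> : \sum_(block_start K <= n < block_start K.+1) block_coef n
    = ((2 * K).+4 * r K (block_start K))%:R * K.+1%:R^-1.
  rewrite mulr_natl -[X in _ *+ X](addKn (block_start K)) -sumr_const_nat.
  by apply: eq_big_nat => n Kn; rewrite /block_coef (block_indexE _ _ Kn).
rewrite ler_pdivlMr ?ltr0n// mul1r ler_nat.
have := r_gt0 K (block_start K); nia.
Qed.

(** A zero digit puts [8 ^ m * t] within [8 ^ - q] above an integer, where [m] starts the run and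
    [q] is its length. For [m <= l < m + q], multiplying by [8 ^ (l - m)] leaves [8 ^ l * t] within
    1/8 above an integer, so every cosine in the run is at least 1/2. *)
Lemma block_nonzero_digit (t : R) N0 k i :
  (forall m n, (N0 <= m)%N -> (m <= n)%N ->
    \sum_(m <= l < n) block_coef l * cos (2 * pi * ((8 ^ l)%:R * t)) <= 1) ->
  (N0 <= k)%N -> (i < r k (block_start k))%N ->
  ~ exists j : nat,
     j%:R <= (8 ^ block_start k * (8 ^ (2 * k).+4) ^ i)%:R * t
          <= j%:R + (8 ^ (2 * k).+4)%:R^-1.
Proof.
move=> hsum Nk ir [j].
set q := (2 * k).+4; set m := (block_start k + q * i)%N.
rewrite -expnM -expnD -/m => /andP[j1 j2].
have km : (block_start k <= m)%N by exact: leq_addr.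
have mk : (m + q <= block_start k.+1)%N.
  by rewrite /= -/q -addnA leq_add2l addnC -mulnS leq_mul2l ir orbT.
have := hsum m (m + q)%N; move=> /(_ _ (leq_addr _ _)).
move=> /(_ (leq_trans Nk (leq_trans (ltnW (ltn_block_start k)) km))).
apply/negP; rewrite -ltNge.
(* The lower bound is [q / (2 (k + 1)) = (k + 2) / (k + 1)], which exceeds 1. *)
apply: (@lt_le_trans _ _ (\sum_(m <= l < m + q) k.+1%:R^-1 * (1 / 2))).
  rewrite sumr_const_nat addKn -mulrnAr -[_ *+ q]mulr_natr.
  rewrite mulrC ltr_pdivlMr ?ltr0n// mul1r /q -natr1.
  rewrite (_ : (2 * k).+4%:R = 2 * k%:R + 4 :> R); first lra.
  by rewrite -addn4 natrD natrM.
rewrite big_nat [leRHS]big_nat; apply: ler_sum => l /andP[ml lq].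
rewrite /block_coef (@block_indexE k); last first.
  by rewrite (leq_trans km ml) (leq_trans lq mk).
rewrite ler_pM2l ?invr_gt0 ?ltr0n//.
have lE : (8 ^ l)%:R * t = (8 ^ (l - m))%:R * ((8 ^ m)%:R * t) :> R.
  by rewrite mulrA -natrM -expnD subnK.
apply: (@cos_ge_half _ _ (8 ^ (l - m) * j)).
  by rewrite lE natrM ler_wpM2l ?ler0n.
rewrite lE natrM; apply: (le_trans (ler_wpM2l _ j2)); first exact: ler0n.
rewrite mulrDr lerD2l ler_pdivrMr ?ltr0n ?expn_gt0// mulrC ler_pdivlMr//.
by rewrite -natrM -expnSr ler_nat leq_exp2l//; lia.
Qed.

End lacunary_blocks.

(** * Arcs of a uniform grid *)

Lemma grid_arc_turn (R : realType) (D j : nat) :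
  j%:R / D.+1%:R <= j.+1%:R / D.+1%:R :> R /\
  j.+1%:R / D.+1%:R <= j%:R / D.+1%:R + 1 :> R.
Proof.
have D0 : 0 < D.+1%:R :> R by rewrite ltr0n.
split; first by rewrite ler_pM2r ?invr_gt0// ler_nat.
by rewrite -[in leLHS]natr1 mulrDl mul1r lerD2l invf_le1// ler1n.
Qed.

(** The grid has [D.+1] cells. *)
Definition grid_arc (R : realType) (D j : nat) : Defs.arc R :=
  @Arc R (j%:R / D.+1%:R) (j.+1%:R / D.+1%:R) true true
    (grid_arc_turn R D j).1 (grid_arc_turn R D j).2.

Lemma arc_length_grid (R : realType) (D j : nat) :
  arc_length (grid_arc R D j) = D.+1%:R^-1.
Proof. by rewrite /arc_length /= -mulrBl -[j.+1%:R]natr1 addrC addKr mul1r. Qed.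

Lemma mem_grid_arc (R : realType) (D j : nat) (t : R) :
  j%:R <= D.+1%:R * t < j.+1%:R -> arc_set (grid_arc R D j) (circle_point t).
Proof.
move=> /andP[j1 j2]; exists t => //=.
rewrite in_itv /= ler_pdivrMr ?ltr0n// ler_pdivlMr ?ltr0n// mulrC j1.
exact: ltW.
Qed.

(** * The map [z ^+ 8] and the conclusion *)

Lemma expr8_blaschke (R : realType) :
  finite_blaschke0 (fun z : R[i] => z ^+ 8).
Proof.
exists 1, 8%N, [::]; split=> //; first exact: normr1.
by move=> z _; rewrite /blaschke big_nil mul1r mulr1.
Qed.

(** At [z = 1/2] the moduli would be [2 ^ -8] and [2 ^ -1]. *)
Lemma expr8_not_rotation (R : realType) : ~ rotation (fun z : R[i] => z ^+ 8).
Proof.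
case=> alpha alpha1 /(_ 2^-1).
have h2 : `|2^-1 : R[i]| = 2^-1 by rewrite ger0_norm ?invr_ge0 ?ler0n.
rewrite h2 invf_lt1 ?ltr0n// ltr1n => /(_ isT).
move=> /(congr1 (fun z : R[i] => `|z|)) /=.
rewrite normrX [RHS]normrM alpha1 h2 mul1r => /eqP.
by rewrite exprVn (inj_eq (@invr_inj _)) -natrX eqr_nat.
Qed.

Theorem theorem3 (R : realType) (phi : R -> R)
    (hphi : measure_function phi)
    (hlim : forall s : R, 0 < s -> s < 1 ->
       phi t / (t `^ s) @[t --> 0^'+] --> (0 : R)) :
  exists f : R[i] -> R[i],
    [/\ finite_blaschke0 f, ~ rotation f &
    exists a : nat -> R[i],
      [/\ (a n : R[i]^o) @[n --> \oo] --> (0 : R[i]^o),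
          (\sum_(1 <= n <oo) (Normc.normc (a n))%:E)%E = +oo%E &
          forall w : R[i], hausdorff_measure phi (sum_level_set a f w) = 0%E]].
Proof.
have [r hr] : exists r : nat -> nat -> nat, forall k s, (0 < r k s)%N /\
    (8 ^ s * (8 ^ (2 * k).+4).-1 ^ r k s)%:R *
      phi ((8 ^ s * (8 ^ (2 * k).+4) ^ r k s)%:R^-1) <= 1 / (2 ^ k.+1)%:R.
  have ex k s : exists m, (0 < m)%N /\
      (8 ^ s * (8 ^ (2 * k).+4).-1 ^ m)%:R *
      phi ((8 ^ s * (8 ^ (2 * k).+4) ^ m)%:R^-1) <= 1 / (2 ^ k.+1)%:R.
    apply: measure_function_digits => //; first by rewrite expn_gt0.
    by apply: (@leq_trans (8 ^ 1)) => //; rewrite leq_exp2l.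
  exists (fun k => projT1 (choice (ex k))) => k.
  exact: projT2 (choice (ex k)).
have r0 k s : (0 < r k s)%N by case: (hr k s).
pose c := block_coef R r r0.
have c_gt0 n : 0 < c n by rewrite invr_gt0 ltr0n.
exists (fun z => z ^+ 8).
split; [exact: expr8_blaschke|exact: expr8_not_rotation|].
exists (fun n => (c n)%:C%C); split.
- apply/cvgrPdist_lt => eps eps0.
  (* A positive element of [R[i]] is real, so the bound can be proved in [R]. *)
  have epsE : (complex.Re eps)%:C%C = eps by exact/RRe_real/gtr0_real.
  have e0 : 0 < complex.Re eps by rewrite -ltcR epsE.
  pose k := Num.truncn (complex.Re eps)^-1.
  exists (block_start r k) => // n /= kn.
  rewrite sub0r normrN -epsE normc_def /= expr0n /= addr0 sqrtr_sqr.
  rewrite gtr0_norm// ltcR; apply: le_lt_trans (block_coef_le R r r0 k n kn) _.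
  by rewrite invf_plt ?posrE ?ltr0n// truncnS_gt.
- have normcE n : Normc.normc (c n)%:C%C = c n.
    by rewrite /Normc.normc /= expr0n /= addr0 sqrtr_sqr gtr0_norm.
  under eq_eseriesr do rewrite normcE.
  apply/eq_infty => A.
  have [K AK] : exists K, A <= K%:R.
    by exists (Num.truncn A).+1; exact/ltW/truncnS_gt.
  apply: le_trans (nneseries_lim_ge (block_start r K) _); last first.
    by move=> n _ _; rewrite lee_fin ltW.
  by rewrite sumEFin lee_fin (le_trans AK)// block_coef_sum.
move=> w; apply: hausdorff_measure_eq0 => // delta eps delta0 eps0.
(* Only blocks from [K0] on are used: late enough for cells shorter than [delta] and for
   [2 ^ - K0 <= eps]. *)
pose K0 := (Num.truncn eps^-1 + Num.truncn delta^-1).+1.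
have K0_lt (x : R) k : 0 < x -> (Num.truncn x^-1 <= K0 + k)%N ->
    ((K0 + k).+1%:R : R)^-1 < x.
  move=> x0 xK; rewrite invf_plt ?posrE ?ltr0n//.
  by apply: lt_le_trans (truncnS_gt _) _; rewrite ler_nat.
pose S k := block_start r (K0 + k).
pose B k := (8 ^ (2 * (K0 + k)).+4)%N.
pose m k := r (K0 + k)%N (S k).
pose N k := (8 ^ S k * B k ^ m k)%N.
pose L k := nonzero_digits (8 ^ S k) (B k) (m k).
have B1 k : (1 < B k)%N by rewrite -(expn0 8) ltn_exp2l.
have N0 k : (0 < N k)%N by rewrite muln_gt0 !expn_gt0.
have NK k : (N k).-1.+1 = N k by rewrite prednK.
exists (fun k => size (L k)).
exists (fun k i => grid_arc R (N k).-1 (nth 0%N (L k) i)).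
split.
- move=> x [/unit_circleP[t t01 ->] /iterate_series_Cauchy[M hM]].
  (* The bound on sums holds from index [M] on, and batch [M] describes block [K0 + M], which is
     late enough. Since [M] depends on the point, all batches are needed to cover the level set. *)
  have [j jL jt] : exists2 j, j \in L M & j%:R <= (N M)%:R * t < j.+1%:R.
    apply: nonzero_digitsP => //; first by rewrite expn_gt0.
    move=> i im; apply: (block_nonzero_digit R r r0 t M) => //.
    by rewrite leq_addl.
  exists M, (index j (L M)); split; first by rewrite index_mem.
  by apply: mem_grid_arc; rewrite nth_index// NK.
- move=> k i; rewrite arc_length_grid NK.
  (* The grid has [N k >= 8 ^ S k > S k > K0 + k] cells. *)
  apply: le_lt_trans (_ : ((K0 + k).+1%:R : R)^-1 < delta).
    rewrite lef_pV2 ?posrE ?ltr0n// ler_nat.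
    have h1 := ltn_block_start r r0 (K0 + k).
    have h2 : (S k < 8 ^ S k)%N by exact: ltn_expl.
    apply: leq_trans (leq_trans h1 (ltnW h2)) _.
    by rewrite leq_pmulr// expn_gt0 ltnW.
  by apply: K0_lt => //; rewrite /K0; lia.
- move=> k.
  under eq_bigr do rewrite arc_length_grid NK.
  rewrite sumr_const_nat subn0 -[phi _ *+ _]mulr_natl size_nonzero_digits.
  apply: le_trans (hr (K0 + k)%N (S k)).2 _.
  (* The bound [1 / 2 ^ (K0 + k).+1] splits as [2 ^ - K0] times [1 / 2 ^ k.+1], and
     [2 ^ - K0 <= 1 / (K0 + 1) < eps]. *)
  rewrite -addnS expnD natrM invfM mulrA mul1r.
  rewrite ler_pM2r ?invr_gt0 ?ltr0n ?expn_gt0//.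
  apply: le_trans (ltW (K0_lt eps 0%N eps0 _)); last by rewrite /K0; lia.
  by rewrite lef_pV2 ?posrE ?ltr0n ?expn_gt0// ler_nat addn0 ltn_expl.
Qed.
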